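(* Let $k\in\mathbb N$, $k\ge2$, and let $E$ be a Banach function space with the Fatou property. If $x\in E^+$ is a point of local fully $k$-rotundity of $E$, then $x$ is a point of order continuity of $E$. Additionally, if $E^+$ is locally fully $k$-rotund, then $E$ is order continuous.
   Context: Let $I=[0,\alpha)$, $\alpha=1$ or $\alpha=\infty$, with Lebesgue measure, and $L^0$ the set of (classes of) extended real valued measurable functions on $I$. A Banach function space $(E,\|\cdot\|_E)$ is a Banach lattice that is a sublattice of $L^0$ such that (1) if $x\in L^0$, $y\in E$, $|x|\le|y|$ a.e., then $x\in E$ and $\|x\|_E\le\|y\|_E$; (2) there is a strictly positive $x\in E$. $E^+=\{x\in E:x\ge0\}$; $S_E$ is the unit sphere. Fatou property: if $(x_n)\subset E^+$, $\sup_n\|x_n\|_E<\infty$ and $x_n\uparrow x\in L^0$, then $x\in E$ and $\|x_n\|_E\uparrow\|x\|_E$. A point $x\in S_E$ is a point of local fully $k$-rotundity if for every sequence $(x_n)\subset S_E$ such that $\|x+\sum_{i=1}^k x_{n,i}\|_E\to k+1$ as $n\to\infty$ for any $k$ subsequences $(x_{n,1})_n,\dots,(x_{n,k})_n$ of $(x_n)$, one has $\|x_n-x\|_E\to0$. $E^+$ is locally fully $k$-rotund if the same condition holds considering only nonnegative elements: for every $x\in S_E\cap E^+$ and every $(x_n)\subset S_E\cap E^+$ such that $\|x+\sum_{i=1}^k x_{n,i}\|_E\to k+1$ for any $k$ subsequences of $(x_n)$, one has $\|x_n-x\|_E\to0$. A point $x\in E$ is a point of order continuity if for any sequence $(x_n)\subset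 E^+$ with $x_n\le|x|$ and $x_n\to0$ a.e. one has $\|x_n\|_E\to0$; $E$ is order continuous if every $x\in E$ is such a point. *)

(* Defs.v *)
From HB Require Import structures.
From mathcomp Require Import all_boot all_order all_algebra.
From mathcomp Require Import all_classical all_reals all_analysis.
From mathcomp Require Import measurable_realfun.
Set Implicit Arguments.
Unset Strict Implicit.
Unset Printing Implicit Defensive.
Import Order.TTheory GRing.Theory Num.Theory.
Import numFieldNormedType.Exports.
Local Open Scope classical_set_scope.
Local Open Scope ring_scope.

Definition dom (R : realType) (alpha : \bar R) : set R :=
  [set t : R | 0 <= t /\ (t%:E < alpha)%E].

(* The classes in L^0 are handled through representatives [R -> \bar R] that
   are measurable on [dom alpha], compared almost everywhere on [dom alpha].
   (The sigma-algebra is the Borel one; every Lebesgue measurable function is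
   a.e. equal to a Borel one, so the classes are the same.) *)

Definition L0 (R : realType) (alpha : \bar R) (f : R -> \bar R) : Prop :=
  measurable_fun (dom alpha) f.

Definition ae_on (R : realType) (alpha : \bar R) (P : R -> Prop) : Prop :=
  \forall t \ae (@lebesgue_measure R), dom alpha t -> P t.

Definition ae_eq_on (R : realType) (alpha : \bar R) (f g : R -> \bar R) : Prop :=
  ae_on alpha (fun t => f t = g t).

Definition ae_le_on (R : realType) (alpha : \bar R) (f g : R -> \bar R) : Prop :=
  ae_on alpha (fun t => (f t <= g t)%E).

(* [ev] identifies the Banach space with a set of classes in L^0: it is linear
   and injective modulo a.e. equality.  Although L^0 contains extended real
   valued functions and is not a vector space, the members of a vector space of
   such classes are a.e. finite, so the sums in [ev_add] are a.e. sums of real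
   numbers.  The order is that of L^0, so the suprema and infima of a sublattice
   are the a.e. pointwise ones.  The compatibility of the norm with the order
   (Banach lattice) is the norm inequality in [ev_ideal], since the [x] obtained
   there is unique by [ev_inj]. *)
Record banach_function_space (R : realType) (alpha : \bar R) := BFS {
  bfs_space :> completeNormedModType R ;
  ev : bfs_space -> R -> \bar R ;
  ev_L0 : forall x, L0 alpha (ev x) ;
  ev_fin : forall x, ae_on alpha (fun t => ev x t \is a fin_num) ;
  ev_inj : forall x y, ae_eq_on alpha (ev x) (ev y) -> x = y ;
  ev_add : forall x y,
    ae_eq_on alpha (ev (x + y)) (fun t => ev x t + ev y t)%E ;
  ev_scale : forall (a : R) x,
    ae_eq_on alpha (ev (a *: x)) (fun t => a%:E * ev x t)%E ;
  ev_sup : forall x y, exists z,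
    ae_eq_on alpha (ev z) (fun t => maxe (ev x t) (ev y t)) ;
  ev_inf : forall x y, exists z,
    ae_eq_on alpha (ev z) (fun t => mine (ev x t) (ev y t)) ;
  ev_ideal : forall (g : R -> \bar R) y, L0 alpha g ->
    ae_le_on alpha (fun t => `|g t|%E) (fun t => `|ev y t|%E) ->
    exists2 x, ae_eq_on alpha (ev x) g & `|x| <= `|y| ;
  ev_pos : exists x, ae_on alpha (fun t => (0 < ev x t)%E)
}.

Section Notions.
Variables (R : realType) (alpha : \bar R) (E : banach_function_space alpha).
Implicit Types (x : E) (u : nat -> E).

Definition nonneg x : Prop := ae_le_on alpha (fun=> 0%E) (ev x).

Definition unit_sphere x : Prop := `|x| = 1.

Definition Fatou_property : Prop :=
  forall u (g : R -> \bar R),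
    (forall n, nonneg (u n)) ->
    has_ubound (range (fun n => `|u n|)) ->
    L0 alpha g ->
    (forall n, ae_le_on alpha (ev (u n)) (ev (u n.+1))) ->
    ae_on alpha (fun t => (fun n => ev (u n) t) @ \oo --> g t) ->
    exists x, [/\ ae_eq_on alpha (ev x) g,
      nondecreasing_seq (fun n => `|u n|) &
      (fun n => `|u n|) @ \oo --> `|x| ].

Definition rotund_sequence (k : nat) x u : Prop :=
  forall s : 'I_k -> nat -> nat, (forall i, increasing_seq (s i)) ->
    (fun n => `|x + \sum_(i < k) u (s i n)|) @ \oo --> (k.+1%:R : R).

Definition local_fully_rotund_point (k : nat) x : Prop :=
  unit_sphere x /\
  forall u, (forall n, unit_sphere (u n)) -> rotund_sequence k x u ->
    (fun n => `|u n - x|) @ \oo --> (0 : R).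

Definition positive_cone_locally_fully_rotund (k : nat) : Prop :=
  forall x u, unit_sphere x -> nonneg x ->
    (forall n, unit_sphere (u n)) -> (forall n, nonneg (u n)) ->
    rotund_sequence k x u ->
    (fun n => `|u n - x|) @ \oo --> (0 : R).

Definition order_continuity_point x : Prop :=
  forall u, (forall n, nonneg (u n)) ->
    (forall n, ae_le_on alpha (ev (u n)) (fun t => `|ev x t|%E)) ->
    ae_on alpha (fun t => (fun n => ev (u n) t) @ \oo --> (0%E : \bar R)) ->
    (fun n => `|u n|) @ \oo --> (0 : R).

Definition order_continuous : Prop := forall x, order_continuity_point x.

End Notions.

Arguments Fatou_property {R alpha} E.
Arguments positive_cone_locally_fully_rotund {R alpha} E k.
Arguments order_continuous {R alpha} E.

(* Main.v *)
(* If |x| = 1, 0 <= u_n <= x and u_n -> 0 a.e., then the tail suprema v_n = sup_(m >= n) u_m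
   decrease to 0, so w_n = x - v_n increases to x and the Fatou property gives
   |w_n| -> |x| = 1.  For m >= n the normalization w_m / |w_m| dominates w_m,
   hence w_n, so that k + 1 >= |x + sum_i w_(m_i) / |w_(m_i)|| >= (k + 1) |w_n|
   for all m_i >= n: the normalized sequence satisfies the rotundity condition
   at x.  Hence w_n -> x, i.e. |v_n| -> 0, and u_n <= v_n.  All the elements
   involved are nonnegative, so for the second assertion this applies to the
   normalization of |x|. *)

Require Import Defs.
From mathcomp Require Import all_boot all_order all_algebra.
From mathcomp Require Import all_classical all_reals all_analysis.
From mathcomp Require Import measurable_realfun.

Set Implicit Arguments.
Unset Strict Implicit.
Unset Printing Implicit Defensive.
Import Order.TTheory GRing.Theory Num.Theory.
Import numFieldNormedType.Exports.
Local Open Scope classical_set_scope.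
Local Open Scope ring_scope.

(** * Combining properties that hold almost everywhere on the domain *)

Section AlmostEverywhere.
Variables (R : realType) (alpha : \bar R).
Implicit Types (P Q : R -> Prop).

Let filter_ae : Filter (almost_everywhere (@lebesgue_measure R)).
Proof. exact: ae_filter_ringOfSetsType. Qed.

Lemma ae_onS P Q : (forall t, P t -> Q t) -> ae_on alpha P -> ae_on alpha Q.
Proof. by move=> PQ; apply: (@filterS _ _ filter_ae) => t Pt /Pt/PQ. Qed.

Lemma ae_onI P Q :
  ae_on alpha P -> ae_on alpha Q -> ae_on alpha (fun t => P t /\ Q t).
Proof. apply: (@filterS2 _ _ filter_ae) => t Pt Qt tD; split; [exact: Pt|exact: Qt]. Qed.

Lemma ae_on_foralln (P : nat -> R -> Prop) :
  (forall n, ae_on alpha (P n)) -> ae_on alpha (fun t => forall n, P n t).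
Proof. by move=> /ae_foralln; apply: (@filterS _ _ filter_ae) => t Pt tD n; exact: Pt. Qed.

Lemma ae_onT P : (forall t, P t) -> ae_on alpha P.
Proof. by move=> h; exact: (@filterE _ _ filter_ae). Qed.

End AlmostEverywhere.

(** * The order of [E], its link with the norm, and tail suprema *)

Section Order.
Variables (R : realType) (alpha : \bar R) (E : banach_function_space alpha).
Implicit Types (x y z : E) (u v : nat -> E).

Definition ele x y : Prop := ae_le_on alpha (ev x) (ev y).

Lemma ev_zero : ae_eq_on alpha (ev (0 : E)) (fun=> 0%E).
Proof.
have := ev_scale 0 (0 : E); rewrite scale0r.
by apply: ae_onS => t ->; rewrite mul0e.
Qed.

Lemma nonnegE x : nonneg x <-> ele 0 x.
Proof.
by split=> h; apply: ae_onS (ae_onI ev_zero h) => t [->].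
Qed.

Lemma ele_trans y x z : ele x y -> ele y z -> ele x z.
Proof. by move=> xy yz; apply: ae_onS (ae_onI xy yz) => t []; exact: le_trans. Qed.

Lemma ele_refl x : ele x x.
Proof. by apply: ae_onT. Qed.

Lemma eleD x y z w : ele x y -> ele z w -> ele (x + z) (y + w).
Proof.
move=> xy zw.
apply: ae_onS (ae_onI (ae_onI xy zw) (ae_onI (ev_add x z) (ev_add y w))).
by move=> t [[h1 h2] [-> ->]]; exact: leeD.
Qed.

Lemma eleZ (a : R) x y : 0 <= a -> ele x y -> ele (a *: x) (a *: y).
Proof.
move=> a0 xy.
apply: ae_onS (ae_onI xy (ae_onI (ev_scale a x) (ev_scale a y))).
by move=> t [h1 [-> ->]]; apply: lee_wpmul2l; rewrite ?lee_fin.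
Qed.

Lemma ele_subr_ge0 x y : ele 0 (y - x) <-> ele x y.
Proof.
split=> [/(eleD (ele_refl x))|/(eleD (ele_refl (- x)))].
  by rewrite addr0 addrC subrK.
by rewrite addNr addrC.
Qed.

Lemma ele0Z (a : R) x : 0 <= a -> ele 0 x -> ele 0 (a *: x).
Proof. by move=> a0 x0; rewrite -(scaler0 _ a); exact: eleZ. Qed.

Lemma ele_sum (I : finType) (f g : I -> E) :
  (forall i, ele (f i) (g i)) -> ele (\sum_i f i) (\sum_i g i).
Proof.
move=> fg; elim/big_ind2: _ => //; first exact: ele_refl.
by move=> ? ? ? ?; exact: eleD.
Qed.

(** The ideal property applied to [ev x] yields an element of norm at most that of [y]; by
    injectivity of [ev] it is [x] itself. *)
Lemma norm_ele x y : ele 0 x -> ele x y -> `|x| <= `|y|.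
Proof.
move=> x0 xy.
have [|x' /ev_inj <-//] := @ev_ideal _ _ _ _ y (ev_L0 x).
apply: ae_onS (ae_onI (proj2 (nonnegE x) x0) xy) => t [h0 h].
by rewrite !gee0_abs// (le_trans h0).
Qed.

Lemma exists_abs x : exists2 y, ele 0 y &
  ae_eq_on alpha (ev y) (fun t => `|ev x t|%E).
Proof.
have [||y ey _] := @ev_ideal _ _ _ (fun t => `|ev x t|%E) x.
- exact: measurableT_comp (ev_L0 x).
- by apply: ae_onT => t; rewrite abse_id.
exists y => //; apply/nonnegE.
by apply: ae_onS ey => t ->.
Qed.

(** The pointwise suprema of the tails are measurable and lie between 0 and [z], so the ideal
    property puts them in [E]. They tend to the upper limit of [u], which is 0 almost everywhere. *)
Lemma exists_tail_sup z u :
  (forall n, ele 0 (u n)) -> (forall n, ele (u n) z) ->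
  ae_on alpha (fun t => ev (u n) t @[n --> \oo] --> (0%E : \bar R)) ->
  exists v, [/\ forall n, ele (u n) (v n), forall n, ele (v n.+1) (v n),
    forall n, ele (v n) z &
    ae_on alpha (fun t => ev (v n) t @[n --> \oo] --> (0%E : \bar R))].
Proof.
move=> u0 uz ucvg; pose g n t := esups (fun m => ev (u m) t) n.
have ug n t : (ev (u n) t <= g n t)%E.
  by apply: ereal_sup_ubound; exists n => /=.
have gz : ae_on alpha (fun t => forall n, (g n t <= ev z t)%E).
  apply: ae_onS (ae_on_foralln uz) => t h n.
  by apply: ge_ereal_sup => _ [m _ <-]; exact: h.
have g0 : ae_on alpha (fun t => forall n, (0 <= g n t)%E).
  apply: ae_onS (ae_on_foralln (fun n => proj2 (nonnegE _) (u0 n))) => t h n.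
  exact: le_trans (h n) (ug n t).
have /choice[v vg] n : exists v : E, ae_eq_on alpha (ev v) (g n).
  have [||v gv _] := @ev_ideal _ _ _ (g n) z; last by exists v.
  - by apply: measurable_fun_esups => m; exact: ev_L0.
  - apply: ae_onS (ae_onI gz g0) => t [hz h0].
    by rewrite !gee0_abs// (le_trans (h0 n)).
exists v; split.
- by move=> n; apply: ae_onS (vg n) => t ->.
- move=> n; apply: ae_onS (ae_onI (vg n) (vg n.+1)) => t [-> ->].
  exact: nonincreasing_esups.
- by move=> n; apply: ae_onS (ae_onI (vg n) gz) => t [->].
- apply: ae_onS (ae_onI (ae_on_foralln vg) ucvg) => t [h uc].
  rewrite (_ : (fun n => _) = esups (fun m => ev (u m) t)); last exact/funext.
  exact: cvg_esups.
Qed.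

(** The elements [z - v n] are nonnegative, increase to [z] almost everywhere and have norm at most
    that of [z]. The limit element given by the Fatou property is [z] by injectivity of [ev]. *)
Lemma Fatou_sub_norm z v : Fatou_property E ->
  (forall n, ele 0 (v n)) -> (forall n, ele (v n.+1) (v n)) ->
  (forall n, ele (v n) z) ->
  ae_on alpha (fun t => ev (v n) t @[n --> \oo] --> (0%E : \bar R)) ->
  `|z - v n| @[n --> \oo] --> `|z|.
Proof.
move=> hF v0 vS vz vcvg.
have subE n : ae_eq_on alpha (ev (z - v n)) (fun t => ev z t - ev (v n) t)%E.
  have := ae_onI (ev_add z (- v n)) (ev_scale (-1) (v n)).
  by rewrite scaleN1r; apply: ae_onS => t [-> ->]; rewrite EFinN mulN1e.
have [||||//|x [xz _ cv]] := hF (fun n => z - v n) (ev z).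
- by move=> n; apply/nonnegE/ele_subr_ge0.
- exists `|z| => _ [n _ <-]; apply: norm_ele; first exact/ele_subr_ge0.
  by apply/ele_subr_ge0; rewrite subKr.
- exact: ev_L0.
- by move=> n; apply/ele_subr_ge0; rewrite addrAC subKr; apply/ele_subr_ge0.
- apply: ae_onS (ae_onI vcvg (ae_onI (ae_on_foralln subE) (ev_fin z))).
  move=> t [vc [h zf]].
  rewrite (_ : (fun n => _) = (fun n => ev z t - ev (v n) t)%E); last exact/funext.
  rewrite -[X in _ --> X]sube0; apply: cvgeB => //; last exact: cvg_cst.
  by rewrite fin_num_adde_defl.
- by move: cv; rewrite (ev_inj xz).
Qed.

End Order.

(** * From rotundity to order continuity *)

Section Core.
Variables (R : realType) (alpha : \bar R) (E : banach_function_space alpha).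
Implicit Types (x y z : E) (u v : nat -> E).

Lemma rotund_sequence_normalized k x w : `|x| = 1 ->
  (forall n, ele 0 (w n)) -> (forall n, ele (w n) x) ->
  {homo w : m n / (m <= n)%N >-> ele m n} ->
  (forall n, 0 < `|w n|) -> `|w n| @[n --> \oo] --> (1 : R) ->
  rotund_sequence k x (fun n => `|w n|^-1 *: w n).
Proof.
move=> x1 w0 wx wnd wpos wcvg s sinc.
have w1 n : `|w n| <= 1 by rewrite -x1; exact: norm_ele.
apply: (@squeeze_cvgr _ _ _ _ (fun n => k.+1%:R * `|w n|) (cst k.+1%:R)).
- apply: nearW => n; apply/andP; split.
  (* Of the [k.+1] copies of [w n], one lies below [x] and each of the others below one term of the
     sum. *)
  + rewrite mulr_natl -normrMn; apply: norm_ele.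
      by rewrite -scaler_nat; apply: ele0Z => //; exact: w0.
    rewrite mulrS; apply: eleD; first exact: wx.
    rewrite -[X in _ *+ X]card_ord -sumr_const; apply: ele_sum => i.
    (* Needed to compare [w n] with [w (s i n)] by monotonicity. *)
    have nsi : (n <= s i n)%N.
      elim: n => // n IH; apply: leq_ltn_trans IH _.
      by have /increasing_seqP/(_ n) := sinc i.
    apply: ele_trans (wnd _ _ nsi) _.
    (* Since [w m] has norm at most 1, dividing it by its norm can only enlarge it. *)
    set m := s i n; apply/ele_subr_ge0.
    rewrite -[X in _ - X]scale1r -scalerBl; apply: ele0Z; last exact: w0.
    by rewrite subr_ge0 invf_ge1.
  + rewrite (le_trans (ler_normD _ _))// x1 mulrS lerD2l.
    rewrite (le_trans (ler_norm_sum _ _ _))//.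
    rewrite -[X in _ <= X%:R]card_ord -sumr_const ler_sum// => i _.
    by rewrite normrZ normfV normr_id mulVf// gt_eqF.
- by rewrite -[X in _ --> X]mulr1; apply: cvgM => //; exact: cvg_cst.
- exact: cvg_cst.
Qed.

(** Rotundity is assumed at the single point [x] and for nonnegative sequences only, a form that the
    hypotheses of both assertions provide. *)
Lemma norm_cvg0_of_rotund k x u : Fatou_property E -> `|x| = 1 ->
  (forall u, (forall n, unit_sphere (u n)) -> (forall n, nonneg (u n)) ->
    rotund_sequence k x u -> `|u n - x| @[n --> \oo] --> (0 : R)) ->
  (forall n, ele 0 (u n)) -> (forall n, ele (u n) x) ->
  ae_on alpha (fun t => ev (u n) t @[n --> \oo] --> (0%E : \bar R)) ->
  `|u n| @[n --> \oo] --> (0 : R).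
Proof.
move=> hF x1 rot u0 ux ucvg.
have [v [uv vS vx vcvg]] := exists_tail_sup u0 ux ucvg.
have v0 n : ele 0 (v n) by apply: ele_trans (u0 n) (uv n).
have ncvg := Fatou_sub_norm hF v0 vS vx vcvg.
rewrite x1 in ncvg.
(* The norms tend to 1, so they are positive from some [N] on; shifting by [N] makes every
   normalization meaningful. *)
have [N _ Npos] : \forall n \near \oo, 0 < `|x - v n|.
  by apply: (cvgr_gt _ ncvg); exact: ltr01.
pose w n := x - v (n + N)%N.
have wpos n : 0 < `|w n| by apply: Npos => /=; exact: leq_addl.
have w0 n : ele 0 (w n) by exact/ele_subr_ge0.
have wx n : ele (w n) x by apply/ele_subr_ge0; rewrite subKr.
have w1 n : `|w n| <= 1 by rewrite -x1; exact: norm_ele.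
have wnd : {homo w : m n / (m <= n)%N >-> ele m n}.
  apply: homo_leq => [y|y a b|n]; [exact: ele_refl|exact: ele_trans|].
  by apply/ele_subr_ge0; rewrite addrAC subKr; apply/ele_subr_ge0; exact: vS.
have wcvg : `|w n| @[n --> \oo] --> (1 : R).
  by rewrite -(cvg_shiftn N) in ncvg.
have zcvg := rot _ _ _ (rotund_sequence_normalized (k := k) x1 w0 wx wnd wpos wcvg).
have {}zcvg : `|(`|w n|^-1 *: w n) - x| @[n --> \oo] --> (0 : R).
  apply: zcvg => n.
    by rewrite /unit_sphere normrZ normfV normr_id mulVf// gt_eqF.
  by apply/nonnegE; apply: ele0Z.
rewrite -(cvg_shiftn N).
apply: (@squeeze_cvgr _ _ _ _ (cst 0)
  (fun n => (1 - `|w n|) + `|(`|w n|^-1 *: w n) - x|)).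
- apply: nearW => n; rewrite normr_ge0 /=.
  apply: (@le_trans _ _ `|v (n + N)%N|); first exact: norm_ele.
  (* Passing through the normalization of [w n] splits [v (n + N) = x - w n] into a multiple of
     [w n], of norm one minus that of [w n], and the difference controlled by rotundity. *)
  have -> : v (n + N)%N = (`|w n|^-1 - 1) *: w n - ((`|w n|^-1 *: w n) - x).
    by rewrite scalerBl scale1r [RHS]addrC opprB addrA subrK subKr.
  rewrite (le_trans (ler_normB _ _))// lerD2r normrZ ger0_norm.
    by rewrite mulrBl mul1r mulVf// gt_eqF.
  by rewrite subr_ge0 invf_ge1.
- exact: cvg_cst.
- rewrite -[X in _ --> X]addr0; apply: cvgD => //.
  by rewrite -[X in _ --> X](subrr (1 : R)); apply: cvgB => //; exact: cvg_cst.
Qed.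

End Core.

Theorem proposition4p4 (R : realType) (alpha : \bar R)
    (halpha : alpha = 1%E \/ alpha = +oo%E)
    (E : banach_function_space alpha) (k : nat) (hk : (2 <= k)%N)
    (hF : Fatou_property E) :
  (forall x : E, nonneg x -> local_fully_rotund_point k x ->
     order_continuity_point x) /\
  (positive_cone_locally_fully_rotund E k -> order_continuous E).
Proof.
split=> [x x0 [x1 rot] u u0 ux ucvg|rot x u u0 ux ucvg].
  apply: (norm_cvg0_of_rotund (k := k) hF x1 _ _ _ ucvg).
  - by move=> w w1 _; exact: rot.
  - by move=> n; apply/nonnegE.
  - move=> n; apply: ae_onS (ae_onI (ux n) x0) => t [h h0].
    by rewrite -(gee0_abs h0).
have {}u0 n : ele 0 (u n) by apply/nonnegE.
have [y y0 yx] := exists_abs x.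
have uy n : ele (u n) y by apply: ae_onS (ae_onI (ux n) yx) => t [h ->].
(* If [y] is 0 it cannot be normalized, but then every [u n] has norm 0. *)
have [yE|yn0] := eqVneq y 0.
  rewrite (_ : (fun n => _) = cst 0); first exact: cvg_cst.
  apply/funext => n; apply/eqP.
  by rewrite eq_le normr_ge0 andbT -(normr0 E) -yE; exact: norm_ele.
have a0 : 0 <= `|y|^-1 by rewrite invr_ge0.
have yn : `|y| != 0 by rewrite normr_eq0.
have x1 : `|(`|y|^-1 *: y)| = 1 by rewrite normrZ normfV normr_id mulVf.
(* The sequence is rescaled along with [y] to lie below a unit vector; multiplying by the norm of
   [y] undoes this. *)
have /(cvgM (cvg_cst `|y|)) : `|(`|y|^-1 *: u n)| @[n --> \oo] --> (0 : R).
  apply: (norm_cvg0_of_rotund (k := k) hF x1).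
  - by move=> w w1 w0; apply: rot => //; apply/nonnegE; exact: ele0Z.
  - by move=> n; exact: ele0Z.
  - by move=> n; exact: eleZ.
  - have sE := ae_on_foralln (fun n => ev_scale `|y|^-1 (u n)).
    apply: ae_onS (ae_onI sE ucvg) => t [h uc].
    rewrite (_ : (fun n => _) = (fun n => `|y|^-1%:E * ev (u n) t)%E).
      by rewrite -[X in _ --> X](mule0 `|y|^-1%:E); apply: cvgeZl.
    exact/funext.
rewrite mulr0 (_ : _ \* _ = fun n => `|u n|) //; apply/funext => n /=.
by rewrite normrZ normfV normr_id mulrA mulfV// mul1r.
Qed.
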